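(* If $n$ and $m$ are integers with $n\geq 2$ and $1\leq m\leq n^2$, then $$\psi_n(m)\leq\sqrt{m}+\frac{\sqrt{\lceil m/n\rceil}}{2}.$$
   Context: The trace norm $\|A\|_*$ of a matrix $A$ is the sum of its singular values. For integers $n\geq 2$ and $1\leq m\leq n^2$, $\mathbb{Z}_n(m)$ denotes the set of $(0,1)$-matrices of size $n\times n$ with exactly $m$ entries equal to $1$, and $\psi_n(m)=\min\{\|A\|_* : A\in\mathbb{Z}_n(m)\}$. *)

(* Defs.v *)
From HB Require Import structures.
From mathcomp Require Import all_boot all_order all_algebra.
From mathcomp Require Import polyrcf complex.

Set Implicit Arguments.
Unset Strict Implicit.
Unset Printing Implicit Defensive.

Import Order.TTheory GRing.Theory Num.Theory.
Local Open Scope ring_scope.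

(* The eigenvalues of A^T A, each repeated according to its multiplicity as a
   root of the characteristic polynomial.  No eigenvalue is missed by
   enumerating real roots only: see char_poly_gram. *)
Definition gram_eigenvalues (R : rcfType) (m n : nat) (A : 'M[R]_(m, n)) :
    seq R :=
  let p := char_poly (A^T *m A) in
  flatten [seq nseq (mup x p) x | x <- rootsR p].

(* There are n of them; for m < n at least n - m vanish, so that their sum
   does not depend on the convention for how many zeros are listed. *)
Definition singular_values (R : rcfType) (m n : nat) (A : 'M[R]_(m, n)) :
    seq R :=
  [seq Num.sqrt x | x <- gram_eigenvalues A].

Definition trace_norm (R : rcfType) (m n : nat) (A : 'M[R]_(m, n)) : R :=
  \sum_(s <- singular_values A) s.

(* (0,1)-matrices are encoded by boolean matrices, so that they form a
   finType; mx01 is the corresponding real matrix. *)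
Definition mx01 (R : rcfType) (n : nat) (A : 'M[bool]_n) : 'M[R]_n :=
  \matrix_(i, j) (A i j)%:R.

Definition Zset (n m : nat) : {set 'M[bool]_n} :=
  [set A : 'M[bool]_n | #|[set ij : 'I_n * 'I_n | A ij.1 ij.2]| == m].

(* The value 0 is junk: Zset n m is inhabited as soon as m <= n ^ 2. *)
Definition psi (R : rcfType) (n m : nat) : R :=
  if [pick A in Zset n m] is Some A0 then
    trace_norm (mx01 R [arg min_(A < A0 in Zset n m) trace_norm (mx01 R A)]%O)
  else 0.

Lemma Zset_neq0 n m : (m <= n ^ 2)%N -> exists A, A \in Zset n m.
Proof.
move=> le_m.
have [B _ cB] : exists2 B : {set 'I_n * 'I_n}, B \subset setT & #|B| = m.
  have: (m <= #|[set: 'I_n * 'I_n]|)%N.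
    by rewrite cardsT card_prod !card_ord mulnn.
  case/card_geqP => s [us <- _].
  by exists [set x in s]; rewrite ?subsetT // cardsE; apply/card_uniqP.
exists (\matrix_(i, j) ((i, j) \in B)); rewrite inE -cB; apply/eqP.
by apply: eq_card => -[i j]; rewrite !inE mxE.
Qed.

Lemma psiP (R : rcfType) (n m : nat) : (m <= n ^ 2)%N ->
  (exists2 A, A \in Zset n m & trace_norm (mx01 R A) = psi R n m) /\
  (forall A, A \in Zset n m -> psi R n m <= trace_norm (mx01 R A)).
Proof.
move=> /Zset_neq0[B BZ]; rewrite /psi.
case: pickP => [A0 A0Z|/(_ B)]; last by rewrite BZ.
by case: arg_minP => // A AZ minA; split => //; exists A.
Qed.

Section Gram.
Variables (R : rcfType) (m n : nat) (A : 'M[R]_(m, n)).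
Let p := char_poly (A^T *m A).

Lemma gram_eigenvalue_ge0 x : root p x -> 0 <= x.
Proof.
rewrite -eigenvalue_root_char => /eigenvalueP[v vE v0].
have sq k (w : 'rV[R]_k) : (w *m w^T) 0 0 = \sum_j w 0 j ^+ 2.
  by rewrite mxE; apply: eq_bigr => j _; rewrite mxE expr2.
have sq_ge0 k (w : 'rV[R]_k) : 0 <= (w *m w^T) 0 0.
  by rewrite sq sumr_ge0 // => j _; exact: sqr_ge0.
have v_gt0 : 0 < (v *m v^T) 0 0.
  rewrite lt_def sq_ge0 andbT; apply: contra v0; rewrite sq psumr_eq0.
    move=> /allP h; apply/eqP/rowP => j; rewrite mxE.
    by apply/eqP; rewrite -sqrf_eq0; apply: h; rewrite mem_index_enum.
  by move=> j _; exact: sqr_ge0.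
have := sq_ge0 _ (v *m A^T).
rewrite trmx_mul trmxK mulmxA -(mulmxA v) vE -scalemxAl [in X in X -> _]mxE.
by rewrite pmulr_lge0.
Qed.

Lemma gram_split : exists s : seq R, p = \prod_(x <- s) ('X - x%:P).
Proof.
pose f : {rmorphism R -> R[i]} := real_complex R.
pose B := map_mx f (A^T *m A).
have Bh : B \is hermsymmx.
  apply/is_hermitianmxP; rewrite expr0 scale1r.
  apply/matrixP => i j; rewrite !mxE /=.
  apply: etrans (esym (conjc_real _)); congr (real_complex R _).
  by apply: eq_bigr => k _; rewrite !mxE mulrC.
have /orthomx_spectralP BE := hermitian_normalmx Bh.
have dR := hermitian_spectral_diag_real Bh.
set P := spectralmx B in BE; set d := spectral_diag B in BE dR.
have Pu : P \in unitmx := spectral_unit B.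
exists [seq complex.Re (d 0 i) | i <- index_enum 'I_n].
apply: (map_poly_inj f); rewrite map_char_poly -/B BE.
have -> : char_poly (invmx P *m diag_mx d *m P) = char_poly (diag_mx d).
  have PVP : map_mx polyC (invmx P) *m map_mx polyC P = 1%:M.
    by rewrite -map_mxM mulVmx // map_mx1.
  rewrite /char_poly /char_poly_mx.
  have -> : 'X%:M - map_mx polyC (invmx P *m diag_mx d *m P) =
     map_mx polyC (invmx P) *m ('X%:M - map_mx polyC (diag_mx d))
       *m map_mx polyC P.
    by rewrite mulmxBr mulmxBl !map_mxM scalar_mxC -[_%:M *m _ *m _]mulmxA PVP mulmx1.
  by rewrite !det_mulmx mulrAC -det_mulmx PVP det1 mul1r.
rewrite char_poly_trig ?diag_mx_is_trig // big_map rmorph_prod.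
apply: eq_bigr => i _; rewrite mxE eqxx mulr1n rmorphB /= map_polyX map_polyC /=.
by have /mxOverP/(_ 0 i)/Creal_ReP/= := dR => {1}<-; rewrite complexRe.
Qed.

Lemma char_poly_gram :
  char_poly (A^T *m A) = \prod_(s <- singular_values A) ('X - (s ^+ 2)%:P).
Proof.
have [s ps] := gram_split.
have p0 : p != 0 by rewrite monic_neq0 ?char_poly_monic.
have rE x : (x \in rootsR p) = root p x.
  by have /(_ x) := roots_on_rootsR p0; rewrite inE.
have perm : perm_eq (gram_eigenvalues A) s.
  apply/allP => x _ /=; apply/eqP; rewrite /gram_eigenvalues -/p count_flatten.
  rewrite -map_comp -mu_prod_XsubC -ps sumnE big_map.
  have [rx|nrx] := boolP (root p x); last first.
    rewrite mupNroot // big_seq big1 // => y; rewrite rE => ry /=.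
    by rewrite count_nseq /=; case: eqP => // yx; rewrite -yx ry in nrx.
  rewrite (bigD1_seq x) ?rE ?uniq_roots //= count_nseq /= eqxx mul1n.
  by rewrite big1 ?addn0 // => y /negPf yx; rewrite count_nseq /= yx.
rewrite -/p ps -(perm_big _ perm) big_map big_seq [RHS]big_seq /=.
apply: eq_bigr => x; rewrite (perm_mem perm) => xs; rewrite sqr_sqrtr //.
by apply: gram_eigenvalue_ge0; rewrite ps root_prod_XsubC.
Qed.

End Gram.

(* Main.v *)
Require Import Defs.
From mathcomp Require Import all_boot all_order all_algebra.
From mathcomp Require Import reals.
From mathcomp Require Import ring lra zify.
Import Order.TTheory GRing.Theory Num.Theory.
Local Open Scope ring_scope.

(** A single matrix witnesses the bound. With k = ceil (m / n), write
    m = a * k + s where s < k, and fill a k x n block of rows column by column: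
    a full columns of height k followed by one column of height s
    ([block_column]). This matrix has rank at most 2, so at most two singular
    values x and y are nonzero, and
      (x + y) ^ 2 = (x ^ 2 + y ^ 2) + 2 x y,
    where x ^ 2 and y ^ 2 are the eigenvalues of a 2 x 2 matrix with the same
    nonzero spectrum as the Gram matrix. Hence the trace norm is governed by
    the trace and the determinant of a 2 x 2 matrix
    ([trace_norm_sqr_factor2]), which here equal m and a s (k - s)
    ([trace_norm_block_column]). By AM-GM, a s (k - s) <= a k ^ 2 / 4
    <= m k / 4, so that the squared trace norm is at most m + sqrt m * sqrt k,
    and completing the square gives sqrt m + sqrt k / 2.

    The 2 x 2 matrix comes from the identity
    X ^ r det (X - M N) = X ^ n det (X - N M) ([char_poly_mulmxC]), applied to
    a factorization of the Gram matrix through a space of dimension 2. *)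

Set Implicit Arguments.
Unset Strict Implicit.

(** * Trace norms through a factorization of the Gram matrix *)

(** Both sides are the determinant of one block matrix K with diagonal blocks
    X and 1 and off-diagonal blocks M and N: one block elimination clears N,
    the other clears the same block after scaling its rows by X. *)
Lemma char_poly_mulmxC (R : comNzRingType) (n r : nat)
    (M : 'M[R]_(n, r)) (N : 'M[R]_(r, n)) :
  'X^r * char_poly (M *m N) = 'X^n * char_poly (N *m M).
Proof.
rewrite /char_poly /char_poly_mx !map_mxM.
set M' := map_mx _ M; set N' := map_mx _ N.
pose K := block_mx 'X%:M M' N' 1%:M.
have detK : \det K = \det ('X%:M - M' *m N').
  have := det_mulmx K (block_mx 1%:M 0 (- N') 1%:M).
  rewrite mulmx_block !mulmx1 !mulmx0 mul1mx !mulmxN subrr !add0r.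
  by rewrite det_ublock det_lblock !det1 !mulr1 => ->.
have := det_mulmx (block_mx 1%:M 0 (- N') 'X%:M) K.
rewrite mulmx_block !mul1mx !mul0mx mulmx1 !addr0 !mulNmx scalar_mxC addNr.
by rewrite det_ublock det_lblock !det_scalar expr1n mul1r detK addrC.
Qed.

(** The squared singular values and the roots of the small characteristic
    polynomial agree up to zeros, and zeros do not contribute to the sum of the
    square roots. The small polynomial splits with nonnegative roots because it
    divides a power of X times the product of the X - s ^ 2. *)
Lemma trace_norm_factor (R : rcfType) (p n r : nat) (A : 'M[R]_(p, n))
    (M : 'M[R]_(n, r)) (N : 'M[R]_(r, n)) : A^T *m A = M *m N ->
  exists s : seq R, [/\ char_poly (N *m M) = \prod_(x <- s) ('X - x%:P),
    all (fun x => 0 <= x) s & trace_norm A = \sum_(x <- s) Num.sqrt x].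
Proof.
move=> AE; have := char_poly_mulmxC M N; rewrite -AE char_poly_gram.
have XnE k : 'X^k = \prod_(x <- nseq k (0 : R)) ('X - x%:P).
  by rewrite big_nseq -Monoid.iteropE subr0.
pose sq := [seq x ^+ 2 | x <- singular_values A].
rewrite (XnE r) -[X in _ * X = _](big_map (fun x => x ^+ 2) predT
  (fun x => 'X - x%:P)) -/sq -big_cat /= => E.
have [|msk] := @dvdp_prod_XsubC _ _ (nseq r 0 ++ sq) id (char_poly (N *m M)).
  by rewrite E dvdp_mull.
set s := mask _ _ => sE; exists s.
have {}sE : char_poly (N *m M) = \prod_(x <- s) ('X - x%:P).
  by apply/eqP; rewrite -eqp_monic ?char_poly_monic ?monic_prod_XsubC.
split=> //.
  apply/allP => x /mem_mask; rewrite mem_cat => /orP[/nseqP[-> //]|].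
  by case/mapP=> y _ ->; exact: sqr_ge0.
move: E; rewrite sE XnE -big_cat /= => /prod_XsubC_eq sP.
have := perm_big _ sP : \sum_(x <- _) Num.sqrt x = \sum_(x <- _) Num.sqrt x.
have sum0 k : \sum_(x <- nseq k (0 : R)) Num.sqrt x = 0.
  by rewrite big1_seq // => x /andP[_ /nseqP[-> _]]; rewrite sqrtr0.
rewrite !big_cat /= !sum0 !add0r big_map => <-; apply: eq_big_seq => x.
by case/mapP=> y _ ->; rewrite sqrtr_sqr ger0_norm ?sqrtr_ge0.
Qed.

Lemma trace_norm_sqr_factor2 (R : rcfType) (p n : nat) (A : 'M[R]_(p, n))
    (M : 'M[R]_(n, 2)) (N : 'M[R]_(2, n)) : A^T *m A = M *m N ->
  trace_norm A ^+ 2 = \tr (N *m M) + 2 * Num.sqrt (\det (N *m M)).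
Proof.
case/trace_norm_factor => [s [sE s0 ->]].
have szs : size s = 2.
  by apply/eqP; rewrite -eqSS -(size_prod_XsubC s id) -sE size_char_poly.
move: sE s0; case: s szs => [|x [|y []]] //= _ sE /and3P[x0 y0 _].
have trE := char_poly_trace (N *m M) isT; have dE := char_poly_det (N *m M).
move: trE dE; rewrite sE !big_cons !big_nil !mulr1 /= addr0.
have -> : ('X - x%:P) * ('X - y%:P) = 'X^2 - (x + y) *: 'X + (x * y)%:P.
  by rewrite polyCM -mul_polyC polyCD; ring.
rewrite !coefE /= !mulr0 !subr0 !mulr1 !add0r sqrrN expr1n mul1r => trE <-.
rewrite sqrtrM // sqrrD !sqr_sqrtr // -mulr_natl -(opprK (\tr _)) -trE; ring.
Qed.

(** * A (0,1)-matrix of rank at most 2 *)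

Lemma sum_ord_lt (R : pzSemiRingType) (n c : nat) : (c <= n)%N ->
  \sum_(i < n) (i < c)%N%:R = c%:R :> R.
Proof.
move=> cn; rewrite -natr_sum; congr _%:R.
rewrite -big_mkcond -(big_ord_widen n (fun=> 1%N)) //.
by rewrite sum1_card card_ord.
Qed.

Definition block_column (n k a s : nat) : 'M[bool]_n :=
  \matrix_(i, j)
    (i < if (j < a)%N then k else if j == a :> nat then s else 0)%N.

Section BlockColumn.
Variables (R : rcfType) (n k a s : nat).
Hypotheses (sk : (s < k)%N) (kn : (k <= n)%N) (an : (a <= n)%N).
Hypothesis s0 : (a == n) ==> (s == 0)%N.

Let height (j : 'I_2) := if j == 0 then k else s.
Let P : 'M[R]_(n, 2) := \matrix_(i, j) (i < height j)%N%:R.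
Let Q : 'M[R]_(2, n) :=
  \matrix_(i, j) (if i == 0 then (j < a)%N else j == a :> nat)%:R.

Let block_columnE : mx01 R (block_column n k a s) = P *m Q.
Proof.
apply/matrixP=> i j; rewrite !mxE big_ord_recl big_ord1 !mxE /=.
by case: (ltngtP j a) => _; rewrite ?mulr1 ?mulr0 ?addr0 ?add0r ?ltn0.
Qed.

Let gramP : P^T *m P = \matrix_(i, j) (minn (height i) (height j))%:R.
Proof.
apply/matrixP=> i j; rewrite !mxE -(@sum_ord_lt R n); last first.
  by rewrite geq_min /height; case: ifP; rewrite ?kn // (leq_trans (ltnW sk)).
by apply: eq_bigr => l _; rewrite !mxE -natrM mulnb leq_min.
Qed.

(* The entry (a < n) vanishes when the partial column falls outside. *)
Let gramQ : Q *m Q^T = diag_mx (\row_i (if i == 0 then a else (a < n)%N)%:R).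
Proof.
have sum_eq : \sum_(i < n) (i == a :> nat)%:R = (a < n)%N%:R :> R.
  case: ltnP => an'; last first.
    by rewrite big1 // => i _; rewrite (ltn_eqF (leq_trans (ltn_ord i) an')).
  rewrite (bigD1 (Ordinal an')) //= eqxx big1 ?addr0 // => i.
  by rewrite -val_eqE /= => /negPf->.
have disj (j : 'I_n) : (j < a)%N && (j == a :> nat) = false by case: ltngtP.
apply/matrixP=> i j; rewrite !mxE.
under eq_bigr => l _ do rewrite !mxE -natrM mulnb.
case: i => [[|[|//]]] ?; case: j => [[|[|//]]] ? /=; rewrite ?mulr0n ?mulr1n.
- by under eq_bigr => l _ do rewrite andbb; rewrite sum_ord_lt.
- by rewrite big1 // => l _; rewrite disj.
- by rewrite big1 // => l _; rewrite andbC disj.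
- by under eq_bigr => l _ do rewrite andbb.
Qed.

Let gramE : (mx01 R (block_column n k a s))^T *m mx01 R (block_column n k a s)
  = Q^T *m (P^T *m P *m Q).
Proof. by rewrite block_columnE trmx_mul !mulmxA. Qed.

Let trE : \tr (P^T *m P *m Q *m Q^T) = (a * k + s)%:R.
Proof.
rewrite -mulmxA gramP gramQ mul_mx_diag /mxtrace big_ord_recl big_ord1 !mxE /=.
rewrite !minnn /height /= -!natrM -natrD mulnC; congr (_ + _)%:R.
move: s0; rewrite implybE ltn_neqAle an andbT.
by case: eqP => //= _; [move/eqP->|]; rewrite ?muln0 ?muln1.
Qed.

Let detE : \det (P^T *m P *m Q *m Q^T) = (a * (s * (k - s)))%:R.
Proof.
rewrite -mulmxA det_mulmx gramP gramQ det_diag big_ord_recl big_ord1 !mxE /=.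
rewrite (expand_det_row _ 0) big_ord_recl big_ord1 /cofactor !det_mx11 !mxE.
rewrite /height /= !minnn minnC (minn_idPl (ltnW sk)).
have -> : (a * (s * (k - s)))%N = ((k - s) * s * (a * (a < n)))%N.
  move: s0; rewrite implybE ltn_neqAle an andbT.
  by case: eqP => [_ /eqP->|_ _]; rewrite ?muln0 ?muln1 // mulnC [(s * _)%N]mulnC.
rewrite -[(0 + 0)%N]/0%N -[(0 + bump 0 0)%N]/1%N expr0 expr1.
by rewrite !natrM (natrB _ (ltnW sk)); ring.
Qed.

(** A (0,1)-matrix equals its entrywise square, so its number of ones is the
    trace of its Gram matrix; this reuses the trace computed for the norm. *)
Lemma block_column_Zset : block_column n k a s \in Zset n (a * k + s).
Proof.
rewrite inE -(eqr_nat R) -trE mxtrace_mulC -gramE /mxtrace.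
have -> : \sum_j ((mx01 R (block_column n k a s))^T *m
      mx01 R (block_column n k a s)) j j
    = \sum_j \sum_i (block_column n k a s i j)%:R.
  apply: eq_bigr => j _; rewrite !mxE; apply: eq_bigr => i _.
  by rewrite [_^T _ _]mxE [mx01 _ _ i j]mxE -natrM mulnb andbb.
rewrite exchange_big pair_bigA -natr_sum eqr_nat -sum1_card big_mkcond.
by apply/eqP/eq_bigr => ij _; rewrite inE; case: (block_column _ _ _ _ _ _).
Qed.

Lemma trace_norm_block_column :
  trace_norm (mx01 R (block_column n k a s)) ^+ 2 =
  (a * k + s)%:R + 2 * Num.sqrt (a * (s * (k - s)))%:R.
Proof. by rewrite (trace_norm_sqr_factor2 gramE) trE detE. Qed.

End BlockColumn.

(** * The bound *)

(** AM-GM on s (k - s) bounds the inner root by sqrt m * sqrt k / 2, where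
    m = a k + s; the right-hand side is then (sqrt m + sqrt k / 2) ^ 2 up to
    the nonnegative term k / 4. *)
Lemma le_sqrt_add_half_sqrt (R : rcfType) (k a s : nat) (T : R) :
  (s <= k)%N ->
  T ^+ 2 = (a * k + s)%:R + 2 * Num.sqrt (a * (s * (k - s)))%:R ->
  T <= Num.sqrt (a * k + s)%:R + Num.sqrt k%:R / 2.
Proof.
move=> sk TE; set m := (a * k + s)%N in TE *.
have root_le : Num.sqrt (a * (s * (k - s)))%:R
    <= Num.sqrt m%:R * Num.sqrt k%:R / 2 :> R.
  rewrite -sqrtrM ?ler0n // -[X in _ <= _ / X]ger0_norm // -sqrtr_sqr.
  rewrite -sqrtrV ?sqr_ge0 // -sqrtrM ?mulr_ge0 ?ler0n // ler_sqrt; last first.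
    by rewrite mulr_ge0 ?mulr_ge0 ?ler0n ?invr_ge0 ?sqr_ge0.
  rewrite ler_pdivlMr ?exprn_gt0 // -natrX -!natrM ler_nat /m.
  have AGM := nat_AGM2 s (k - s); rewrite subnKC // in AGM.
  rewrite -mulnA [(_ * 2 ^ 2)%N]mulnC.
  apply: leq_trans (leq_mul (leqnn a) AGM) _.
  by rewrite mulnDl -mulnA mulnn leq_addr.
have bound_ge0 : 0 <= Num.sqrt m%:R + Num.sqrt k%:R / 2 :> R.
  by rewrite addr_ge0 ?divr_ge0 ?sqrtr_ge0.
apply: le_trans (ler_norm T) _; rewrite -(ger0_norm bound_ge0).
rewrite -ler_sqr ?nnegrE ?normr_ge0 // !real_normK ?num_real // TE.
have := sqr_sqrtr (ler0n R m); have := sqr_ge0 (Num.sqrt k%:R : R).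
by nra.
Qed.

Unset Implicit Arguments.

Theorem proposition5 (R : realType) (n m : nat)
    (hn : (2 <= n)%N) (hm : (1 <= m <= n ^ 2)%N) :
  psi R n m <= Num.sqrt m%:R
               + Num.sqrt (Num.ceil (m%:R / n%:R : R))%:~R / 2.
Proof.
case/andP: hm => m_gt0 m_le.
have n_gt0 : 0 < n%:R :> R by rewrite ltr0n ltnW.
have [k kE] : exists k : nat, Num.ceil (m%:R / n%:R : R) = k.
  exists `|Num.ceil (m%:R / n%:R : R)|%N; rewrite gez0_abs //.
  by rewrite ceil_ge0 (lt_le_trans (ltrN10 _)) // divr_ge0 ?ler0n.
have m_le_kn : (m <= n * k)%N.
  have := ceil_ge (m%:R / n%:R : R).
  by rewrite kE -pmulrn ler_pdivrMr // -natrM ler_nat mulnC.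
have k_le : (k <= n)%N.
  have : Num.ceil (m%:R / n%:R : R) <= n.
    by rewrite ceil_le_int -pmulrn ler_pdivrMr // -natrM ler_nat mulnn.
  by rewrite kE.
have k_gt0 : (0 < k)%N by case: k m_le_kn {kE k_le} => //; lia.
rewrite kE -pmulrn.
have sk : (m %% k < k)%N by rewrite ltn_mod.
have a_le : (m %/ k <= n)%N by rewrite -(mulnK n k_gt0) leq_div2r.
(* The partial column does not fit when all n columns are full, but then
   m <= n k forces it to be empty. *)
have full : (m %/ k == n)%N ==> (m %% k == 0)%N.
  by apply/implyP => /eqP aE; move: m_le_kn; rewrite {1}(divn_eq m k) aE; lia.
have AZ := block_column_Zset R sk k_le a_le full.
have norm_le := le_sqrt_add_half_sqrt (ltnW sk)
  (trace_norm_block_column R sk k_le a_le full).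
rewrite -divn_eq in AZ norm_le.
exact: le_trans ((psiP R m_le).2 _ AZ) norm_le.
Qed.
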